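(* The sequence $(v_e(n))_{n\geq 0}$ satisfies the second order linear recurrence equation $$v_e(n+2)-2\,v_e(n+1)-2\,v_e(n)=0,\qquad n\geq 0,$$ with $v_e(0)=0$ and $v_e(1)=1$, and we have $$v_e(n)=\tfrac{\sqrt{3}}{6}(1+\sqrt{3})^n-\tfrac{\sqrt{3}}{6}(1-\sqrt{3})^n=\sum_{k\geq 0}\binom{n}{2k+1}3^k,\qquad n\geq 0.$$ Moreover, its generating function is given by $V_e(z)=-z/(2z^2+2z-1)$. Furthermore, for any integer $n\geq 1$, we have $v_a(n)=2v(n-1)$, $v_{ea}(n)=2v_e(n-1)$, and $v_a(0)=v_{ea}(0)=0$.
   Context: $X_n=\{1,\ldots,n\}$ and $\leq_n$ is the total ordering on $X_n$ with $1<_n 2<_n\cdots<_n n$. An operation $F\colon X_n^2\to X_n$ is associative if $F(F(x,y),z)=F(x,F(y,z))$ for all $x,y,z$; quasitrivial if $F(x,y)\in\{x,y\}$ for all $x,y$; $\leq_n$-preserving if $x\leq_n x'$ and $y\leq_n y'$ imply $F(x,y)\leq_n F(x',y')$. An element $e$ is a neutral element of $F$ if $F(x,e)=F(e,x)=x$ for all $x$; an element $a$ is an annihilator element of $F$ if $F(x,a)=F(a,x)=a$ for all $x$. For $n\geq 1$: $v(n)$ is the number of associative, quasitrivial, and $\leq_n$-preserving operations $F\colon X_n^2\to X_n$; $v_e(n)$ is the number of those that have a neutral element; $v_a(n)$ (for $n\geq 2$) is the number of those that have an annihilator element; $v_{ea}(n)$ is the number of those that have distinct neutral and annihilator elements.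 By convention $v(0)=v_e(0)=v_a(0)=v_{ea}(0)=0$ and $v_a(1)=0$. The (ordinary) generating function of a sequence $(s_n)_{n\geq 0}$ is the power series $S(z)=\sum_{n\geq 0}s_n z^n$. *)

(* Defs.v *)
From mathcomp Require Import all_boot all_order all_algebra.
From mathcomp Require Import mathcomp_extra boolp classical_sets fsbigop.

Set Implicit Arguments.
Unset Strict Implicit.
Unset Printing Implicit Defensive.

Import Order.TTheory GRing.Theory Num.Theory.

(* X_n is 'I_n with its natural order; the shift {1..n} ~ {0..n-1} is an order
   isomorphism. *)

Definition quasitrivial (T : Type) (f : T -> T -> T) : Prop :=
  forall x y, f x y = x \/ f x y = y.

Definition order_preserving (n : nat) (f : 'I_n -> 'I_n -> 'I_n) : Prop :=
  forall x x' y y' : 'I_n,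
    (x <= x')%N -> (y <= y')%N -> (f x y <= f x' y')%N.

Definition neutral (T : Type) (f : T -> T -> T) (e : T) : Prop :=
  right_id e f /\ left_id e f.

Definition annihilator (T : Type) (f : T -> T -> T) (a : T) : Prop :=
  right_zero a f /\ left_zero a f.

Definition admissible (n : nat) (f : 'I_n -> 'I_n -> 'I_n) : Prop :=
  [/\ associative f, quasitrivial f & order_preserving f].

Definition count_ops (n : nat) (P : ('I_n -> 'I_n -> 'I_n) -> Prop) : nat :=
  #|[pred F : {ffun 'I_n * 'I_n -> 'I_n} | `[< P (fun x y => F (x, y)) >] ]|.

(* The values at 0, and v_a 1, are conventions: for instance the unique
   operation on the empty set would be counted by [v 0], and the unique
   operation on a singleton would be counted by [v_a 1]. *)

Definition v (n : nat) : nat :=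
  if n == 0 then 0 else count_ops (@admissible n).

Definition v_e (n : nat) : nat :=
  if n == 0 then 0 else
  count_ops (fun f : 'I_n -> 'I_n -> 'I_n =>
    admissible f /\ exists e, neutral f e).

Definition v_a (n : nat) : nat :=
  if (n <= 1)%N then 0 else
  count_ops (fun f : 'I_n -> 'I_n -> 'I_n =>
    admissible f /\ exists a, annihilator f a).

Definition v_ea (n : nat) : nat :=
  if n == 0 then 0 else
  count_ops (fun f : 'I_n -> 'I_n -> 'I_n =>
    admissible f /\ exists e a, [/\ neutral f e, annihilator f a & e <> a]).

Local Open Scope ring_scope.

(* Formal power series in one variable z, represented by their coefficients. *)

Definition fps (R : Type) : Type := nat -> R.

Definition ogf (R : pzRingType) (s : nat -> nat) : fps R := fun n => (s n)%:R.

(* The indeterminate 'X of {poly R} plays the role of z. *)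
Definition fps_poly (R : nzRingType) (p : {poly R}) : fps R := fun n => p`_n.

Definition fps_mul (R : pzRingType) (A B : fps R) : fps R :=
  fun n => \sum_(i < n.+1) A (n - i)%N * B i.

(* [fps_inv_seq B n] lists the first n coefficients of 1 / B, which are
   determined by B 0 * c_n = [n = 0] - \sum_(i < n) B (n - i) * c_i. *)
Fixpoint fps_inv_seq (R : fieldType) (B : fps R) (n : nat) : seq R :=
  if n is m.+1 then
    let s := fps_inv_seq B m in
    rcons s ((B 0)^-1 * ((m == 0)%:R - \sum_(i < m) B (m - i)%N * s`_i))
  else [::].

Definition fps_inv (R : fieldType) (B : fps R) : fps R :=
  fun n => (fps_inv_seq B n.+1)`_n.

Definition fps_div (R : fieldType) (A B : fps R) : fps R :=
  fps_mul A (fps_inv B).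

Lemma size_fps_inv_seq (R : fieldType) (B : fps R) (n : nat) :
  size (fps_inv_seq B n) = n.
Proof. by elim: n => //= n IHn; rewrite size_rcons IHn. Qed.

Lemma nth_fps_inv_seq (R : fieldType) (B : fps R) (m i : nat) :
  (i < m)%N -> (fps_inv_seq B m)`_i = fps_inv B i.
Proof.
elim: m => // m IHm; rewrite ltnS leq_eqVlt => /orP[/eqP-> //|lt_im].
by rewrite /= nth_rcons size_fps_inv_seq lt_im IHm.
Qed.

Lemma fps_mulV (R : fieldType) (B : fps R) :
  B 0%N != 0 -> fps_mul B (fps_inv B) = fps_poly 1.
Proof.
move=> B0; apply/funext => n; rewrite /fps_mul /fps_poly coef1.
rewrite big_ord_recr /= subnn {2}/fps_inv /= nth_rcons size_fps_inv_seq ltnn.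
rewrite eqxx mulrA divff // mul1r.
under [X in _ - X]eq_bigr => i _ do rewrite nth_fps_inv_seq //.
by rewrite addrC subrK.
Qed.

(* Main.v *)
Require Import Defs.
From mathcomp Require Import all_boot all_order all_algebra.
From mathcomp Require Import mathcomp_extra boolp classical_sets fsbigop.
From mathcomp Require Import zify ring.

Import Order.TTheory GRing.Theory Num.Theory.

(* Let [f] be an associative, quasitrivial, order-preserving operation on a
   chain with at least two points, least point 0 and greatest point M. There are
   four cases, according to (f 0 M, f M 0). If both values are 0 (resp. M), then
   0 (resp. M) is an annihilator, and [f] is determined by its restriction to the
   other points, which can be any admissible operation. If (f 0 M, f M 0) is
   (0, M) and [f] has a neutral element, then 0 and M are left zeros which absorb
   all interior points, and [f] is determined by its restriction to the interior;
   the case (M, 0) is dual. Neutral elements survive restriction and extension,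
   whence v_e (n+2) = 2 v_e (n+1) + 2 v_e n, and an annihilator exists exactly in
   the first two cases. *)

(** * Counting operations, and transposing their arguments *)

Lemma eq_count_ops n (P Q : ('I_n -> 'I_n -> 'I_n) -> Prop) :
  (forall f, P f <-> Q f) -> count_ops P = count_ops Q.
Proof. by move=> PQ; apply: eq_card => F; rewrite !inE; apply: asbool_equiv_eq. Qed.

Lemma count_ops_or n (P Q : ('I_n -> 'I_n -> 'I_n) -> Prop) :
  (forall f, P f -> Q f -> False) ->
  count_ops (fun f => P f \/ Q f) = (count_ops P + count_ops Q)%N.
Proof.
move=> PQ; rewrite /count_ops -cardUI [X in _ = (_ + X)%N]eq_card0 ?addn0.
  by apply: eq_card => F; rewrite !inE asbool_or.
by move=> F; rewrite !inE; apply/andP => -[/asboolP ? /asboolP]; apply: PQ.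
Qed.

Definition flip {T : Type} (f : T -> T -> T) : T -> T -> T := fun x y => f y x.

(** Transposition is an involution on tables. It later reduces one mixed corner pattern to the
    other. *)
Lemma count_ops_flip n (P : ('I_n -> 'I_n -> 'I_n) -> Prop) :
  count_ops (fun f => P (flip f)) = count_ops P.
Proof.
pose phi (F : {ffun 'I_n * 'I_n -> 'I_n}) := [ffun p => F (p.2, p.1)].
have phiK : cancel phi phi.
  by move=> F; apply/ffunP => -[x y]; rewrite !ffunE.
rewrite /count_ops -(on_card_preimset (f := phi)); last first.
  by exists phi => F _; apply: phiK.
apply: eq_card => F; rewrite !inE.
suff -> : (fun x y => phi F (x, y)) = flip (fun x y => F (x, y)) by [].
by apply/funext => x; apply/funext => y; rewrite ffunE.
Qed.

Lemma admissible_flip n (f : 'I_n -> 'I_n -> 'I_n) :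
  admissible f -> admissible (flip f).
Proof.
move=> [fA fQ fM]; split=> [x y z|x y|x x' y y' xx' yy'].
- by rewrite /flip fA.
- by rewrite /flip; case: (fQ y x); [right|left].
- exact: fM.
Qed.

(** * Extending an operation from a subchain and restricting it back *)

Section Extension.
Variables (k n : nat) (iota : 'I_k -> 'I_n).
Hypothesis iota_mono : forall i j, (iota i <= iota j)%N = (i <= j)%N.
(** Since only endpoints can be missed, extensions stay order-preserving. *)
Hypothesis extremal : forall x : 'I_n,
  x \notin codom iota -> (x : nat) = 0%N \/ (x : nat) = n.-1.

Lemma iota_inj : injective iota.
Proof.
by move=> i j ij; apply/val_inj/eqP; rewrite eqn_leq -!iota_mono ij leqnn.
Qed.

(** Points off the image are left zeros and absorb the image. If one endpoint is missed, it becomes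
    an annihilator; if both are missed, both become left zeros, as in the case (0, M). *)
Definition extends_image (f : 'I_n -> 'I_n -> 'I_n) : Prop :=
  (forall x y, x \notin codom iota -> f x y = x) /\
  (forall i y, y \notin codom iota -> f (iota i) y = y).

Definition extend (g : 'I_k -> 'I_k -> 'I_k) (x y : 'I_n) : 'I_n :=
  match [pick i | iota i == x], [pick j | iota j == y] with
  | Some i, Some j => iota (g i j)
  | Some _, None => y
  | None, _ => x
  end.

(** Quasitriviality makes the value one of the two arguments, so a test against the first replaces
    inverting [iota]. *)
Definition restrict (f : 'I_n -> 'I_n -> 'I_n) (i j : 'I_k) : 'I_k :=
  if f (iota i) (iota j) == iota i then i else j.

Lemma pick_iota i : [pick j | iota j == iota i] = Some i.
Proof.
by case: pickP => [j /eqP/iota_inj->//|/(_ i)]; rewrite eqxx.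
Qed.

Lemma pick_codomF x : x \notin codom iota -> [pick j | iota j == x] = None.
Proof. by case: pickP => // j /eqP <- /negP[]; apply: codom_f. Qed.

Lemma extend_iota g i j : extend g (iota i) (iota j) = iota (g i j).
Proof. by rewrite /extend !pick_iota. Qed.

Lemma extends_extend g : extends_image (extend g).
Proof.
split=> [x y xN|i y yN]; rewrite /extend ?pick_iota pick_codomF //.
Qed.

Lemma restrict_extend g : quasitrivial g -> restrict (extend g) = g.
Proof.
move=> gQ; apply/funext => i; apply/funext => j; rewrite /restrict extend_iota.
rewrite (inj_eq iota_inj); case: eqP => [->//|]; by case: (gQ i j).
Qed.

Lemma iota_restrict f i j :
  quasitrivial f -> iota (restrict f i j) = f (iota i) (iota j).
Proof. by rewrite /restrict => fQ; case: eqP => // ; case: (fQ (iota i) (iota j)). Qed.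

Lemma extend_restrict f :
  quasitrivial f -> extends_image f -> extend (restrict f) = f.
Proof.
move=> fQ [f1 f2]; apply/funext => x; apply/funext => y.
have [e1 e2] := extends_extend (restrict f).
have [/codomP[i ->]|xN] := boolP (x \in codom iota); last by rewrite e1 ?f1.
have [/codomP[j ->]|yN] := boolP (y \in codom iota); last by rewrite e2 ?f2.
by rewrite extend_iota iota_restrict.
Qed.

Lemma admissible_restrict f : admissible f -> admissible (restrict f).
Proof.
move=> [fA fQ fM]; split=> [x y z|x y|x x' y y' xx' yy'].
- by apply: iota_inj; rewrite !iota_restrict.
- by rewrite /restrict; case: ifP; [left|right].
- by rewrite -iota_mono !iota_restrict //; apply: fM; rewrite iota_mono.
Qed.

(** A product equals its leftmost factor off the image if there is one, and is computed by [g]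
    otherwise; this gives associativity. For monotonicity, a factor off the image is an endpoint, so
    the value is extreme or the factor does not move. *)
Lemma admissible_extend g : admissible g -> admissible (extend g).
Proof.
move=> [gA gQ gM]; have [e1 e2] := extends_extend g.
have cod x : (exists i, x = iota i) \/ x \notin codom iota.
  by have [/codomP|] := boolP (x \in codom iota); [left|right].
split=> [x y z|x y|x x' y y' xx' yy'].
- case: (cod x) => [[i ->]|xN]; last by rewrite !e1.
  case: (cod y) => [[j ->]|yN]; last by rewrite (e1 y) // !e2 // e1.
  case: (cod z) => [[l ->]|zN]; last by rewrite extend_iota !e2.
  by rewrite !extend_iota gA.
- case: (cod x) => [[i ->]|xN]; last by rewrite e1; auto.
  case: (cod y) => [[j ->]|yN]; last by rewrite e2; auto.
  by rewrite extend_iota; case: (gQ i j) => ->; auto.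
(* Moving up from a point cannot reach a new lower endpoint. *)
have up (a a' : 'I_n) : (a <= a')%N -> a' \notin codom iota ->
    (a' : nat) = n.-1 \/ a = a'.
  move=> aa' /extremal[] a'0; last by left.
  by right; apply: val_inj => /=; lia.
have down (a a' : 'I_n) : (a <= a')%N -> a \notin codom iota ->
    (a : nat) = 0%N \/ a = a'.
  move=> aa' /extremal[] a0; first by left.
  by right; apply: val_inj => /=; have := ltn_ord a'; lia.
case: (cod x) => [[i xE]|xN]; last first.
  rewrite e1 //; case: (down _ _ xx' xN) => [->//|xx]; by rewrite -xx e1.
case: (cod x') => [[i' xE']|xN']; last first.
  rewrite (e1 x') //; case: (up _ _ xx' xN') => [->|xx].
    by have := ltn_ord (extend g x y); lia.
  by move: xN'; rewrite -xx xE codom_f.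
case: (cod y) => [[j yE]|yN]; last first.
  rewrite xE e2 //; case: (down _ _ yy' yN) => [->//|yy]; by rewrite -yy xE' e2.
case: (cod y') => [[j' yE']|yN']; last first.
  rewrite xE' (e2 _ y') //; case: (up _ _ yy' yN') => [->|yy].
    by have := ltn_ord (extend g x y); lia.
  by move: yN'; rewrite -yy yE codom_f.
rewrite xE xE' yE yE' !extend_iota iota_mono; apply: gM.
  by rewrite -iota_mono -xE -xE'.
by rewrite -iota_mono -yE -yE'.
Qed.

(** A neutral element off the image would also be a left zero, so that [y = f e y = e] for all [y],
    against [1 < n]. *)
Lemma neutral_restrict f e : (1 < n)%N -> quasitrivial f -> extends_image f ->
  neutral f e -> exists i, neutral (restrict f) i.
Proof.
move=> n1 fQ [f1 _] [fe ef].
have [/codomP[i eE]|eN] := boolP (e \in codom iota).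
  by exists i; split=> j; apply: iota_inj; rewrite iota_restrict // -eE ?fe ?ef.
have all_e y : y = e by rewrite -[LHS]ef f1.
have := congr1 val (all_e (Ordinal (ltnW n1))).
by rewrite -(all_e (Ordinal n1)).
Qed.

Lemma neutral_extend g i : neutral g i -> neutral (extend g) (iota i).
Proof.
move=> [ge eg]; have [e1 e2] := extends_extend g.
split=> x; have [/codomP[j ->]|xN] := boolP (x \in codom iota).
- by rewrite extend_iota ge.
- exact: e1.
- by rewrite extend_iota eg.
- exact: e2.
Qed.

(** [extend] and [restrict] are mutually inverse here. Abstract [P] and [Q] allow one bijection to
    serve with and without neutral elements. *)
Lemma count_ops_extension (P : ('I_n -> 'I_n -> 'I_n) -> Prop)
    (Q : ('I_k -> 'I_k -> 'I_k) -> Prop) :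
  (forall f, P f -> quasitrivial f) -> (forall g, Q g -> quasitrivial g) ->
  (forall f, P f -> extends_image f -> Q (restrict f)) ->
  (forall g, Q g -> P (extend g)) ->
  count_ops (fun f => P f /\ extends_image f) = count_ops Q.
Proof.
move=> Pq Qq PQ QP.
pose fn m (F : {ffun 'I_m * 'I_m -> 'I_m}) x y := F (x, y).
pose ext (G : {ffun 'I_k * 'I_k -> 'I_k}) :=
  [ffun p : 'I_n * 'I_n => extend (fn k G) p.1 p.2].
have extE G : fn n (ext G) = extend (fn k G).
  by apply/funext => x; apply/funext => y; rewrite /fn ffunE.
have inj : {in [pred G | `[< Q (fn k G) >]] &, injective ext}.
  move=> G H; rewrite !inE => QG QH GH.
  suff GHE : fn k G = fn k H.
    by apply/ffunP => -[x y]; apply: (congr1 (fun f => f x y) GHE).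
  have [rG rH] := (restrict_extend _ (Qq _ QG), restrict_extend _ (Qq _ QH)).
  by rewrite -rG -rH -!extE GH.
rewrite /count_ops -(card_in_image inj); apply: eq_card => F.
apply/idP/fintype.imageP => [|[G]]; rewrite !inE.
  move=> [PF eF].
  exists [ffun p => restrict (fn n F) p.1 p.2].
    rewrite !inE.
    suff -> : fn k [ffun p => restrict (fn n F) p.1 p.2] = restrict (fn n F).
      exact: PQ.
    by apply/funext => x; apply/funext => y; rewrite /fn ffunE.
  apply/ffunP => -[x y]; rewrite ffunE /=.
  rewrite -[LHS]/(fn n F x y) -{1}[fn n F]extend_restrict //; last exact: Pq.
  congr (extend _ x y).
  by apply/funext => a; apply/funext => b; rewrite /fn ffunE.
move=> QG ->.
change (P (fn n (ext G)) /\ extends_image (fn n (ext G))).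
by rewrite extE; split; [apply: QP|apply: extends_extend].
Qed.

Lemma count_extensions :
  count_ops (fun f => admissible f /\ extends_image f)
  = count_ops (@admissible k).
Proof.
apply: count_ops_extension => [f []|g []|f fP _|g] //.
  exact: admissible_restrict.
exact: admissible_extend.
Qed.

Lemma count_neutral_extensions : (1 < n)%N ->
  count_ops (fun f => (admissible f /\ exists e, neutral f e) /\ extends_image f)
  = count_ops (fun g : 'I_k -> _ => admissible g /\ exists e, neutral g e).
Proof.
move=> n1.
apply: count_ops_extension => [f [[]]|g [[]]|f [fP [e fe]] fi|g [gP [i gi]]] //.
  split; first exact: admissible_restrict.
  by case: fP => _ fQ _; apply: neutral_restrict fe.
split; first exact: admissible_extend.
by exists (iota i); apply: neutral_extend.
Qed.

End Extension.

(** * Embeddings that miss the least point, the greatest point, or both *)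

Lemma lift0_mono n (i j : 'I_n) :
  (lift ord0 i <= lift ord0 j)%N = (i <= j)%N.
Proof. by rewrite !lift0. Qed.

Lemma lift_max_mono n (i j : 'I_n) :
  (lift ord_max i <= lift ord_max j)%N = (i <= j)%N.
Proof. by rewrite !lift_max. Qed.

Definition middle n (i : 'I_n) : 'I_n.+2 := lift ord0 (lift ord_max i).

Lemma middle_mono n (i j : 'I_n) : (middle n i <= middle n j)%N = (i <= j)%N.
Proof. by rewrite lift0_mono lift_max_mono. Qed.

Lemma codom_lift n (h x : 'I_n) : (x \in codom (lift h)) = (x != h).
Proof.
apply/codomP/idP => [[i ->]|]; first by rewrite eq_sym neq_lift.
by rewrite eq_sym => /unlift_some[i -> _]; exists i.
Qed.

Lemma codom_middle n (x : 'I_n.+2) :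
  (x \in codom (middle n)) = (x != ord0) && (x != ord_max).
Proof.
apply/codomP/andP => [[i ->]|[x0 xM]].
  rewrite eq_sym neq_lift; split=> //.
  by rewrite -val_eqE /= /bump /=; have := ltn_ord i; lia.
have : x \in codom (lift ord0) by rewrite codom_lift.
case/codomP=> y xy; have : y \in codom (lift ord_max).
  rewrite codom_lift; apply: contraNneq xM => yM.
  by rewrite xy yM; apply/eqP/val_inj.
by case/codomP=> i yi; exists i; rewrite xy yi.
Qed.

(** * Values at the two off-diagonal corners of the table *)

Definition corner {n} (a b : 'I_n.+1) (f : 'I_n.+1 -> 'I_n.+1 -> 'I_n.+1) :=
  f ord0 ord_max = a /\ f ord_max ord0 = b.

Section Corners.
Variables (n : nat) (f : 'I_n.+1 -> 'I_n.+1 -> 'I_n.+1).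
Hypothesis fP : admissible f.

Lemma corner_cases :
  (corner ord0 ord0 f \/ corner ord_max ord_max f) \/
  (corner ord0 ord_max f \/ corner ord_max ord0 f).
Proof.
case: fP => _ fQ _; rewrite /corner.
by case: (fQ ord0 ord_max) => ->; case: (fQ ord_max ord0) => ->; tauto.
Qed.

(** Monotonicity squeezes the row: [f 0 y <= f 0 M = 0]. The next three lemmas follow by order
    duality and transposition. *)
Lemma left_zero0 : f ord0 ord_max = ord0 -> forall y, f ord0 y = ord0.
Proof.
case: fP => _ _ fM f0 y; apply: val_inj => /=.
have := fM ord0 ord0 y ord_max (leqnn _) (leq_ord y); rewrite f0 /=; lia.
Qed.

Lemma right_zero0 : f ord_max ord0 = ord0 -> forall x, f x ord0 = ord0.
Proof.
case: fP => _ _ fM f0 y; apply: val_inj => /=.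
have := fM y ord_max ord0 ord0 (leq_ord y) (leqnn _); rewrite f0 /=; lia.
Qed.

Lemma left_zero_max : f ord_max ord0 = ord_max -> forall y, f ord_max y = ord_max.
Proof.
case: fP => _ _ fM f0 y; apply: val_inj => /=.
have := fM ord_max ord_max ord0 y (leqnn _) (leq0n _); rewrite f0 /=.
have := ltn_ord (f ord_max y); lia.
Qed.

Lemma right_zero_max : f ord0 ord_max = ord_max -> forall x, f x ord_max = ord_max.
Proof.
case: fP => _ _ fM f0 y; apply: val_inj => /=.
have := fM ord0 y ord_max ord_max (leq0n _) (leqnn _); rewrite f0 /=.
have := ltn_ord (f y ord_max); lia.
Qed.

Lemma annihilator0P : corner ord0 ord0 f <-> annihilator f ord0.
Proof.
split=> [[f1 f2]|[f1 f2]]; last by split; [apply: f2|apply: f1].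
by split=> x; [apply: right_zero0|apply: left_zero0].
Qed.

Lemma annihilator_maxP : corner ord_max ord_max f <-> annihilator f ord_max.
Proof.
split=> [[f1 f2]|[f1 f2]]; last by split; [apply: f1|apply: f2].
by split=> x; [apply: right_zero_max|apply: left_zero_max].
Qed.

(** In a mixed pattern both endpoints are zeros on the same side, so an annihilator would equal both
    of them. *)
Lemma annihilatorP : (0 < n)%N ->
  (exists a, annihilator f a) <->
  corner ord0 ord0 f \/ corner ord_max ord_max f.
Proof.
move=> n0; have neq : ord0 <> ord_max :> 'I_n.+1.
  by move/(congr1 val) => /= n0'; rewrite -n0' in n0.
split; last first.
  by case=> [/annihilator0P|/annihilator_maxP]; [exists ord0|exists ord_max].
case=> a [ra la]; case: corner_cases => // -[[f1 f2]|[f1 f2]].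
  by case: neq; rewrite -(left_zero0 f1 a) -(left_zero_max f2 a) !ra.
by case: neq; rewrite -(right_zero_max f1 a) -(right_zero0 f2 a) !la.
Qed.

(** With a single missed point, being a left zero and absorbing the image from the right amounts to
    being an annihilator. *)
Lemma extends_lift0P : corner ord0 ord0 f <-> extends_image _ _ (lift ord0) f.
Proof.
split=> [/annihilator0P[f1 f2]|[f1 f2]].
  split=> [x y|i y]; rewrite codom_lift negbK => /eqP ->; first exact: f2.
  exact: f1.
have f0 y : f ord0 y = ord0 by apply: f1; rewrite codom_lift eqxx.
apply/annihilator0P; split=> x //.
have [->|] := eqVneq x ord0; first exact: f0.
rewrite -codom_lift => /codomP[i ->].
by apply: f2; rewrite codom_lift eqxx.
Qed.

Lemma extends_lift_maxP :
  corner ord_max ord_max f <-> extends_image _ _ (lift ord_max) f.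
Proof.
split=> [/annihilator_maxP[f1 f2]|[f1 f2]].
  split=> [x y|i y]; rewrite codom_lift negbK => /eqP ->; first exact: f2.
  exact: f1.
have f0 y : f ord_max y = ord_max by apply: f1; rewrite codom_lift eqxx.
apply/annihilator_maxP; split=> x //.
have [->|] := eqVneq x ord_max; first exact: f0.
rewrite -codom_lift => /codomP[i ->].
by apply: f2; rewrite codom_lift eqxx.
Qed.

End Corners.

(* An interior point [x] with [f x 0 = x] would be a left zero; comparing its
   row with that of the neutral element forces [x] to be extreme. *)
Lemma extends_middleP n (f : 'I_n.+2 -> 'I_n.+2 -> 'I_n.+2) :
  admissible f -> (exists e, neutral f e) ->
  corner ord0 ord_max f <-> extends_image _ _ (middle n) f.
Proof.
move=> fP [e [re le]]; split=> [[f1 f2]|[f1 f2]]; last first.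
  by split; apply: f1; rewrite codom_middle eqxx ?andbF.
have f0 := left_zero0 _ _ fP f1; have fM := left_zero_max _ _ fP f2.
have [fA fQ fmon] := fP.
split=> [x y|i y]; first by rewrite codom_middle negb_and !negbK => /orP[]/eqP->.
have iN : middle n i \in codom (middle n) by apply: codom_f.
move: iN; move: (middle n i) => x; rewrite codom_middle => /andP[x0 xM].
have x0' : (0 < x)%N by rewrite lt0n.
have xM' : (x < n.+1)%N.
  by rewrite ltn_neqAle -ltnS ltn_ord andbT -val_eqE in xM *.
have no_left_zero : (forall z, f x z = x) -> False.
  move=> fx; case: (leqP x e) => xe.
    have := fmon x e ord0 ord0 xe (leqnn _); rewrite fx le /=; lia.
  have := fmon e x ord_max ord_max (ltnW xe) (leqnn _); rewrite fx le /=; lia.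
have sq z : f x ord0 = x -> f x ord_max = x -> f x z = x.
  move=> fx1 fx2; apply: val_inj => /=.
  have := fmon x x ord0 z (leqnn _) (leq0n _).
  have := fmon x x z ord_max (leqnn _) (leq_ord _).
  by rewrite fx1 fx2 => *; apply/eqP; rewrite eqn_leq; apply/andP.
(* Associativity carries the equation across the row: [f x M = f (f x 0) M = f x (f 0 M) = f x 0 =
   x]. *)
have fx0 : f x ord0 = x -> f x ord_max = x.
  by move=> h; rewrite -[in LHS]h -fA f1 h.
have fxM : f x ord_max = x -> f x ord0 = x.
  by move=> h; rewrite -[in LHS]h -fA f2 h.
rewrite codom_middle negb_and !negbK => /orP[]/eqP->.
  case: (fQ x ord0) => // h; case: no_left_zero => z; apply: sq => //; exact: fx0.
case: (fQ x ord_max) => // h; case: no_left_zero => z; apply: sq => //; exact: fxM.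
Qed.

(** * Counting by corner pattern *)

Definition unital {n} (f : 'I_n -> 'I_n -> 'I_n) : Prop :=
  admissible f /\ exists e, neutral f e.

(** The convention at 0 agrees with the count, since an empty set has no neutral element; hence the
    recurrence can start at [n = 0]. *)
Lemma v_eE n : v_e n = count_ops (@unital n).
Proof.
rewrite /v_e; case: n => // /=; apply/esym/eq_card0 => F.
by rewrite inE; apply/asboolP => -[_ [[]]].
Qed.

Lemma count_annihilator_or n (P : ('I_n.+2 -> 'I_n.+2 -> 'I_n.+2) -> Prop) :
  count_ops (fun f => P f /\ (corner ord0 ord0 f \/ corner ord_max ord_max f)) =
  (count_ops (fun f => P f /\ corner ord0 ord0 f) +
   count_ops (fun f => P f /\ corner ord_max ord_max f))%N.
Proof.
rewrite -count_ops_or; last first.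
  by move=> f [_ [e1 _]] [_ [e2 _]]; move: e2; rewrite e1 => /(congr1 val).
by apply: eq_count_ops => f; tauto.
Qed.

Lemma lift0_extremal n (x : 'I_n.+1) :
  x \notin codom (lift ord0) -> (x : nat) = 0%N \/ (x : nat) = n.
Proof. by rewrite codom_lift negbK => /eqP->; left. Qed.

Lemma lift_max_extremal n (x : 'I_n.+1) :
  x \notin codom (lift ord_max) -> (x : nat) = 0%N \/ (x : nat) = n.
Proof. by rewrite codom_lift negbK => /eqP->; right. Qed.

Lemma middle_extremal n (x : 'I_n.+2) :
  x \notin codom (middle n) -> (x : nat) = 0%N \/ (x : nat) = n.+1.
Proof.
by rewrite codom_middle negb_and !negbK => /orP[]/eqP->; [left|right].
Qed.

Lemma count_annihilator n :
  count_ops (fun f : 'I_n.+2 -> _ =>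
    admissible f /\ (corner ord0 ord0 f \/ corner ord_max ord_max f)) =
  (2 * count_ops (@admissible n.+1))%N.
Proof.
rewrite count_annihilator_or mul2n -addnn; congr addn.
  rewrite -(count_extensions _ _ _ (@lift0_mono n.+1) (@lift0_extremal n.+1)).
  by apply: eq_count_ops => f; split=> -[fP /(extends_lift0P _ _ fP)].
rewrite -(count_extensions _ _ _ (@lift_max_mono n.+1) (@lift_max_extremal n.+1)).
by apply: eq_count_ops => f; split=> -[fP /(extends_lift_maxP _ _ fP)].
Qed.

Lemma count_unital_annihilator n :
  count_ops (fun f : 'I_n.+2 -> _ =>
    unital f /\ (corner ord0 ord0 f \/ corner ord_max ord_max f)) =
  (2 * v_e n.+1)%N.
Proof.
rewrite count_annihilator_or mul2n -addnn v_eE; congr addn.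
  rewrite -(count_neutral_extensions _ _ _ (@lift0_mono n.+1) (@lift0_extremal n.+1)) //.
  by apply: eq_count_ops => f; split=> -[fU /(extends_lift0P _ _ fU.1)].
rewrite -(count_neutral_extensions _ _ _ (@lift_max_mono n.+1) (@lift_max_extremal n.+1)) //.
by apply: eq_count_ops => f; split=> -[fU /(extends_lift_maxP _ _ fU.1)].
Qed.

Lemma unital_flip n (f : 'I_n -> 'I_n -> 'I_n) : unital f -> unital (flip f).
Proof.
by move=> [/admissible_flip fP [e [re le]]]; split=> //; exists e.
Qed.

Lemma count_unital_mixed n :
  count_ops (fun f : 'I_n.+2 -> _ =>
    unital f /\ (corner ord0 ord_max f \/ corner ord_max ord0 f)) =
  (2 * v_e n)%N.
Proof.
have mixed : count_ops (fun f : 'I_n.+2 -> _ => unital f /\ corner ord0 ord_max f)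
    = v_e n.
  rewrite v_eE.
  rewrite -(count_neutral_extensions _ _ _ (@middle_mono n) (@middle_extremal n)) //.
  by apply: eq_count_ops => f; split=> -[fU /(extends_middleP _ _ fU.1 fU.2)].
(* One copy of [v_e n] counts the pattern (0, M); the other is transposed to count (M, 0). *)
rewrite mul2n -addnn -{1}mixed -mixed -[X in (_ + X)%N]count_ops_flip.
rewrite -count_ops_or; last by move=> f [_ [e1 _]] [_ [_ e2]]; rewrite /flip e1 in e2.
apply: eq_count_ops => f; split.
  by case=> fU [fc|[c1 c2]]; [left|right; split=> //; apply: unital_flip].
case=> [[fU fc]|[/unital_flip fU [c1 c2]]]; first by split; [|left].
by split=> //; right.
Qed.

Lemma v_e_rec n : v_e n.+2 = (2 * v_e n.+1 + 2 * v_e n)%N.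
Proof.
rewrite -count_unital_annihilator -count_unital_mixed v_eE.
rewrite -count_ops_or; last first.
  move=> f [_ []] [e1 e2] [_ []] [e3 e4];
  by rewrite e1 in e3; rewrite e2 in e4.
apply: eq_count_ops => f; have := @corner_cases _ f.
by rewrite /unital; tauto.
Qed.

Lemma v_e0 : v_e 0 = 0%N. Proof. by []. Qed.

Lemma v_e1 : v_e 1 = 1%N.
Proof.
have only (x y : 'I_1) : x = y by rewrite !ord1.
rewrite v_eE /count_ops.
transitivity #|{: {ffun 'I_1 * 'I_1 -> 'I_1}}|.
  apply: eq_card => F; rewrite !inE; apply/asboolP; split.
    by split=> [x y z|x y|x x' y y' _ _]; [|left|rewrite (only (F _) (F (x', y')))].
  by exists ord0; split=> x.
by rewrite card_ffun card_ord exp1n.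
Qed.

Lemma v_aE n : (0 < n)%N -> v_a n = (2 * v (n - 1))%N.
Proof.
case: n => [|[|n]] // _; rewrite subn1 /= -count_annihilator.
apply: eq_count_ops => f; split=> -[fP fa]; split=> //.
  exact/(annihilatorP _ _ fP).
exact/(annihilatorP _ _ fP).
Qed.

Lemma v_eaE n : (0 < n)%N -> v_ea n = (2 * v_e (n - 1))%N.
Proof.
case: n => [|[|n]] // _.
  (* On one point no two elements are distinct, and the right side is [2 * v_e 0 = 0]. *)
  apply: eq_card0 => F; rewrite inE; apply/asboolP.
  by case=> _ [e [a [_ _]]]; rewrite !ord1.
rewrite subn1 /= -count_unital_annihilator /v_ea /=.
apply: eq_count_ops => f; split=> [[fP [e [a [fe fa _]]]]|[[fP [e fe]] fa]].
  by split; [split=> //; exists e|apply/(annihilatorP _ _ fP) => //; exists a].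
split=> //; move/(annihilatorP _ _ fP) : fa => [//|a fa]; exists e, a; split=> // ea.
(* If [e = a], then [x = f x e = f x a = a] for every [x], impossible with two points. *)
have all_a x : x = a by case: fa => fa _; rewrite -(fa x) -ea; case: fe => ->.
by have := congr1 val (all_a ord0); rewrite -(all_a ord_max).
Qed.

(** * Closed form and binomial sum *)

Local Open Scope ring_scope.

Lemma v_e_closed_form (R : rcfType) n :
  (v_e n)%:R = Num.sqrt 3 / 6 * (1 + Num.sqrt 3) ^+ n
               - Num.sqrt 3 / 6 * (1 - Num.sqrt 3) ^+ n :> R.
Proof.
have : Num.sqrt 3 * Num.sqrt 3 = 3 :> R by rewrite -expr2 sqr_sqrtr // ler0n.
move: (Num.sqrt 3) => s s2.
suff [] : (v_e n)%:R = s / 6 * (1 + s) ^+ n - s / 6 * (1 - s) ^+ n :> R /\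
  (v_e n.+1)%:R = s / 6 * (1 + s) ^+ n.+1 - s / 6 * (1 - s) ^+ n.+1 :> R by [].
(* [1 + s] and [1 - s] are the roots of the characteristic polynomial [X^2 - 2 X - 2]; the claim is
   used for [s] and [- s]. *)
have char (t : R) m : t * t = 3 -> (1 + t) ^+ m.+2 = 2 * (1 + t) ^+ m.+1 + 2 * (1 + t) ^+ m.
  by move=> t2; rewrite !exprS; ring: t2.
elim: n => [|n [IH1 IH2]].
  rewrite v_e0 v_e1 !expr0 !expr1 subrr; split=> //.
  transitivity (s * s / 3); last by field.
  by rewrite s2 divff // pnatr_eq0.
split=> //; rewrite v_e_rec natrD !natrM IH1 IH2 char // (char (- s)) ?mulrNN //.
ring.
Qed.

(** For large [N], [S] and [T] are the coordinates of [(1 + sqrt 3)^n = T n + S n * sqrt 3].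
    Pascal's rule gives [S m.+1 = S m + T m] and [T m.+1 = T m + 3 * S m], whence the recurrence of
    [v_e]. A bound [N] independent of [n] keeps the range fixed during the induction. *)
Lemma sum_odd_binomials N n : (n <= N.*2)%N ->
  v_e n = (\sum_(k < N) 'C(n, 2 * k + 1) * 3 ^ k)%N.
Proof.
pose S m := (\sum_(k < N) 'C(m, 2 * k + 1) * 3 ^ k)%N.
pose T m := (\sum_(k < N.+1) 'C(m, 2 * k) * 3 ^ k)%N.
have TE m : T m = (1 + \sum_(k < N) 'C(m, (2 * k).+2) * 3 ^ k.+1)%N.
  rewrite /T big_ord_recl muln0 bin0 expn0; congr addn.
  by apply: eq_bigr => k _; rewrite lift0 mulnS.
have T_S m : T m.+1 = (T m + 3 * S m)%N.
  rewrite !TE -addnA; congr addn; rewrite big_distrr -big_split /=.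
  by apply: eq_bigr => k _; rewrite binS expnS addn1; ring.
have S_S m : (m < N.*2)%N -> S m.+1 = (S m + T m)%N.
  (* [T] has one term more than [S], so that [T_S] holds without a bound; here that term vanishes
     because [m < 2 * N]. *)
  move=> mN; rewrite /T big_ord_recr /= mul2n bin_small // mul0n addn0.
  rewrite /S -big_split; apply: eq_bigr => k _ /=.
  by rewrite !addn1 binS; ring.
suff: (n <= N.*2)%N -> v_e n = S n /\ ((n < N.*2)%N -> v_e n.+1 = S n.+1).
  by move=> h nN; case: (h nN).
elim: n => [_|n IHn nN].
  have S0 : S 0%N = 0%N by apply: big1 => k _; rewrite addn1 bin0n.
  split=> [|N0]; first by rewrite S0.
  rewrite S_S // S0 TE v_e1 big1 ?addn0 //.
have [IH1 IH2] := IHn (ltnW nN); split; first exact: IH2 nN.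
move=> nN'; rewrite v_e_rec IH2 // IH1 [RHS]S_S // T_S S_S //.
lia.
Qed.

Lemma v_e_sum (R : rcfType) n :
  (v_e n)%:R =
  \sum_(k \in [set: nat]%classic) ('C(n, (2 * k + 1)%N)%:R * 3 ^+ k : R).
Proof.
rewrite (@sum_odd_binomials n n) ?natr_sum; last by rewrite -addnn leq_addr.
(* The support is finite: for [k >= n] the index [2 * k + 1] exceeds [n] and the binomial is 0. *)
rewrite (fsbigE (iota 0 n)) ?iota_uniq //; last first.
  move=> k _; rewrite mem_iota add0n /= -leqNgt => nk.
  by rewrite bin_small ?mul0r //; lia.
rewrite -(big_mkord xpredT (fun k => ('C(n, 2 * k + 1) * 3 ^ k)%:R)).
rewrite /index_iota subn0; apply: eq_big => k; first by rewrite in_setT.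
by rewrite natrM natrX.
Qed.

(** * Generating function *)

Section GeneratingFunction.
Variable R : rcfType.

Let B : fps R := fps_poly (2 *: 'X^2 + 2 *: 'X - 1).

Let B_coef : [/\ B 0 = -1, B 1 = 2, B 2 = 2 & forall n, B n.+3 = 0].
Proof.
rewrite /B /fps_poly; split=> [|||n];
  rewrite !coefE /= ?mulr0 ?mulr1 ?add0r ?addr0 ?subr0 ?sub0r ?oppr0 //.
Qed.

Let B_neq0 : B 0 != 0.
Proof. by case: B_coef => -> _ _ _; rewrite oppr_eq0 oner_neq0. Qed.

Let inv_eq0 : fps_mul B (fps_inv B) 0 = 1.
Proof. by rewrite fps_mulV // /fps_poly coef1. Qed.

Let inv_eqS n : fps_mul B (fps_inv B) n.+1 = 0.
Proof. by rewrite fps_mulV // /fps_poly coef1. Qed.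

(** As [B] has degree 2, the coefficient of degree [n + 2] in [B * B^-1 = 1] involves three
    coefficients of [B^-1] and is the recurrence of [v_e]. *)
Let inv_B n : fps_inv B n = - (v_e n.+1)%:R.
Proof.
have [B0 B1 B2 B3] := B_coef.
have i0 : fps_inv B 0 = -1.
  have := inv_eq0; rewrite /fps_mul big_ord1 subnn B0 mulN1r => h.
  by rewrite -[LHS]opprK h.
have i1 : fps_inv B 1 = -2.
  have := inv_eqS 0; rewrite /fps_mul !big_ord_recr big_ord0 /= B0 B1 i0 => h.
  by rewrite -[LHS]addr0 -h; ring.
suff [] : fps_inv B n = - (v_e n.+1)%:R /\ fps_inv B n.+1 = - (v_e n.+2)%:R by [].
elim: n => [|n [IH1 IH2]].
  by rewrite i0 i1 v_e_rec v_e0 v_e1.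
split=> //; have := inv_eqS n.+1; rewrite /fps_mul !big_ord_recr /= big1 ?add0r.
  rewrite subnn subSnn (_ : (n.+2 - n = 2)%N) ?B0 ?B1 ?B2; last by lia.
  rewrite IH1 IH2 [v_e n.+3]v_e_rec natrD !natrM => h.
  by rewrite -[LHS]addr0 -h; ring.
move=> i _; rewrite (_ : (n.+2 - i = (n - i.+1).+3)%N) ?B3 ?mul0r //.
by have := ltn_ord i; lia.
Qed.

Lemma v_e_ogf :
  ogf R v_e = fps_div (fps_poly (- 'X)) (fps_poly (2 *: 'X^2 + 2 *: 'X - 1)).
Proof.
apply/funext => n; rewrite /fps_div -/B /ogf /fps_mul.
case: n => [|n]; first by rewrite big_ord1 /fps_poly !coefE oppr0 mul0r.
(* The factor [- 'X] keeps only the term [i = n], which undoes the shift and the sign in [inv_B]. *)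
rewrite !big_ord_recr big1 => [|i _].
  by rewrite /= subnn subSnn inv_B /fps_poly !coefE /=; ring.
rewrite /fps_poly !coefE /= (_ : (n.+1 - i == 1)%N = false) ?oppr0 ?mul0r //.
by have := ltn_ord i; lia.
Qed.

End GeneratingFunction.

Theorem proposition4p12 (R : rcfType) :
  [/\ (forall n : nat,
         (v_e n.+2)%:Z - 2 * (v_e n.+1)%:Z - 2 * (v_e n)%:Z = 0)
      /\ v_e 0 = 0%N /\ v_e 1 = 1%N,
      (forall n : nat,
         (v_e n)%:R = Num.sqrt 3 / 6 * (1 + Num.sqrt 3) ^+ n
                      - Num.sqrt 3 / 6 * (1 - Num.sqrt 3) ^+ n :> R
         /\ (v_e n)%:R =
            \sum_(k \in [set: nat]%classic) ('C(n, (2 * k + 1)%N)%:R * 3 ^+ k : R)),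
      ogf R v_e = fps_div (fps_poly (- 'X))
                          (fps_poly (2 *: 'X^2 + 2 *: 'X - 1)),
      (forall n : nat, (1 <= n)%N ->
         v_a n = (2 * v (n - 1))%N /\ v_ea n = (2 * v_e (n - 1))%N)
    & v_a 0 = 0%N /\ v_ea 0 = 0%N].
Proof.
split; last by [].
- by split=> [n|]; [rewrite v_e_rec; lia|split; [|exact: v_e1]].
- by move=> n; split; [apply: v_e_closed_form|apply: v_e_sum].
- exact: v_e_ogf.
- by move=> n n0; split; [apply: v_aE|apply: v_eaE].
Qed.
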